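(* Suppose the reward of each block is a constant $w>0$. Let $s=p\,q\,n$ be the expected number of solutions per round. For every $\delta_1\in(0,0.25)$ such that $4\delta_1(1+s)+s<1$, Bitcoin with fixed target in a synchronous setting is an $(n-1,\;4\delta_1(1+s)+s,\;0)$-EVP according to the utility function absolute rewards, $U^j_T(\mathcal E)=R^j_T(\mathcal E)$.
   Context: Execution model. $\kappa$ is the security parameter. There are $n$ participants $S=\{P_1,\dots,P_n\}$, an environment $\mathcal Z$ and an adversary $\mathcal A$, all probabilistic polynomial-time (PPT) interactive machines; a control program enforces the rules below. The execution proceeds in synchronous rounds; in each round the environment activates the participants in round-robin order. There is one oracle, a random oracle modelling a hash function: each participant may ask at most $q$ queries per round, and each query independently succeeds (yields a valid block extending the chain being worked on, called a solution) with probability $p$. The parameters $n,q,p$ (and block rewards) are fixed, and the target (hence $p$) does not change. Messages are sent through a Diffuse functionality: the adversary sees the messages of honest participants during the round and may delay them until the end of the round, so it may deliver its own messages first (to recipients of its choice); at the end of each round every honest participant has received all messages sent by all other honest participants. An environment is $r$-admissible if it is PPT, gets input $1^{p'(\kappa)}$ for a polynomial $p'$, and runs the protocol for $r=\pi(\kappa)\neq 0$ rounds, $\pi$ a (nonconstant) polynomial, after which it terminates the execution. Bitcoin with fixed target. Each participant keeps a local chain of blocks. An honest participant adopts the longest chain it has received, in case of a tie the one received first (so the adversary's block is always preferred in a tie); in each round it asks all its $q$ queries trying to extend its chain, even after finding a block; if it finds more than one block in a round it sends only the first one; if it receives a block in the middle of a round it does not change what it is extending until the round ends. Adversaries. A static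 adversary controls, from the beginning, a set $T\subseteq S$ of participants; participants outside $T$ follow the protocol (''honest''). A static adversary with fixed cost chooses at the beginning $T$ and, for each controlled participant $P_{i_m}$, the number $q-x_m$ (with $0\le x_m\le q$) of queries that participant asks in every round; otherwise its strategy is arbitrary. $H_T$ is the adversary that controls $T$ and follows the protocol (asking all $q$ queries per participant per round), except that it delivers its messages first when several solutions are produced in the same round. $\mathcal E_{\mathcal Z,\mathcal A}$ denotes the random execution with environment $\mathcal Z$ and adversary $\mathcal A$. Rewards and utility. For $P_j\in S\setminus T$, $R^j_T(\mathcal E)$ is the total reward of the blocks produced by participants in $T$ that are in the local chain of $P_j$ after the last complete round $r$ of $\mathcal E$. Given a utility $U^j_T$ defined for each $P_j\in S\setminus T$, put $U^{\max}_T=\max_{P_j\in S\setminus T}U^j_T$ and $U^{\min}_T=\min_{P_j\in S\setminus T}U^j_T$. EVP. The protocol is a $(t,\epsilon,\epsilon')$-equilibrium with virtual payoffs (EVP) according to $\{U^j_T\}$ if for every PPT static adversary with fixed cost $\mathcal A$ controlling a set $T$ of at most $t$ participants and every $r$-admissible environment $\mathcal Z$, $$U^{\max}_T(\mathcal E'_{\mathcal Z,\mathcal A})\le U^{\min}_T(\mathcal E_{\mathcal Z,H_T})+\epsilon\,|U^{\min}_T(\mathcal E_{\mathcal Z,H_T})|+\epsilon'$$ with overwhelming probability in $\kappa$ (i.e. except with probability negligible in $\kappa$), where $\mathcal E_{\mathcal Z,H_T}$ and $\mathcal E'_{\mathcal Z,\mathcal A}$ are independent executions with the same environment $\mathcal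 Z$. *)

(* Defs.v *)
From HB Require Import structures.
From mathcomp Require Import all_boot all_order all_algebra.
From mathcomp Require Import reals.

Set Implicit Arguments.
Unset Strict Implicit.
Unset Printing Implicit Defensive.

Import Order.TTheory GRing.Theory Num.Theory.
Local Open Scope ring_scope.

(* Rational coefficients: every real polynomial that is integer-valued on the
   positive integers has them. *)
Definition polynomial (f : nat -> nat) : Prop :=
  exists P : {poly rat}, forall k : nat, (0 < k)%N -> (f k)%:R = P.[k%:R].

Definition nonconstant_polynomial (f : nat -> nat) : Prop :=
  exists P : {poly rat}, (1 < size P)%N /\
    forall k : nat, (0 < k)%N -> (f k)%:R = P.[k%:R].

Definition negligible (R : realType) (f : nat -> R) : Prop :=
  forall c : nat, exists K : nat, forall k : nat, (K <= k)%N ->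
    (0 < k)%N -> `|f k| < (k%:R ^+ c)^-1.

(* [Flip a k] continues as [k true] with probability [a], as [k false] with
   probability [1 - a]; successive flips are independent. *)
Inductive dist (R : Type) (A : Type) : Type :=
| Ret of A
| Flip of R & (bool -> dist R A).
Arguments Ret {R A} _.
Arguments Flip {R A} _ _.

Fixpoint bind (R A B : Type) (d : dist R A) (f : A -> dist R B) : dist R B :=
  match d with
  | Ret x => f x
  | Flip a k => Flip a (fun b => bind (k b) f)
  end.

Notation "'let*' x ':=' d 'in' e" := (bind d (fun x => e))
  (at level 200, x pattern, d at level 200, e at level 200, right associativity).

Fixpoint Pr (R : realType) (A : Type) (d : dist R A) (E : A -> bool) : R :=
  match d with
  | Ret x => (E x)%:R
  | Flip a k => a * Pr (k true) E + (1 - a) * Pr (k false) E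
  end.

Definition independent_pair (R A B : Type) (d : dist R A) (e : dist R B) :
    dist R (A * B) :=
  let* x := d in let* y := e in Ret (x, y).

Fixpoint flips (R : Type) (k : nat) (a : R) : dist R bitseq :=
  if k is k'.+1 then
    let* b := Flip a (fun b => Ret b) in
    let* s := flips k' a in
    Ret (b :: s)
  else Ret [::].

(* Binary, least significant bit first; [fuel] only serves termination. *)
Fixpoint bits_rec (fuel m : nat) : bitseq :=
  if fuel is fuel'.+1 then
    if m is 0%N then [::] else odd m :: bits_rec fuel' m./2
  else [::].
Definition bits (m : nat) : bitseq := bits_rec m m.
Definition nat_of_bits (s : bitseq) : nat :=
  foldr (fun (b : bool) m => (b + m.*2)%N) 0%N s.

(* Self-delimiting code: each bit [b] becomes [1 b], and [0] ends the string. *)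
Definition frame (s : bitseq) : bitseq :=
  flatten [seq [:: true; b] | b <- s] ++ [:: false].
Definition encode (fields : seq bitseq) : bitseq := flatten (map frame fields).

Fixpoint decode_rec (acc s : bitseq) : seq bitseq :=
  match s with
  | true :: b :: s' => decode_rec (rcons acc b) s'
  | false :: s' => acc :: decode_rec [::] s'
  | _ => [::]
  end.
Definition decode (s : bitseq) : seq bitseq := decode_rec [::] s.

Record action (Q : Type) := Action {
  next_ctrl : Q;
  consume : bool;        (* advance on the incoming communication tape *)
  write : option bool;   (* [None] is the blank *)
  head_move : option bool;    (* stay / [true] = right / [false] = left *)
  emit : option bool;    (* bit appended to the outgoing message, if any *)
  yield : bool           (* end the current activation *)
}.

(* Probabilistic interactive Turing machine.  The transition depends on the
   control state, the next unread incoming bit, the scanned cell of the work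
   tape, and a fair coin. *)
Record itm := ITM {
  ctrl : finType;
  ctrl0 : ctrl;
  delta : ctrl -> option bool -> option bool -> bool -> action ctrl
}.

(* The work tape is (cells left of the head, nearest first; cells from the head
   on).  Unread incoming bits are kept from one activation to the next. *)
Record config (M : itm) := Config {
  state : ctrl M;
  incoming : bitseq;
  work : seq (option bool) * seq (option bool);
  outgoing : bitseq
}.

(* The security input 1^m is on the work tape at the beginning. *)
Definition config0 (M : itm) (m : nat) : config M :=
  Config (ctrl0 M) [::] ([::], nseq m (Some true)) [::].

Definition tape_step (a : option bool) (mv : option bool)
    (t : seq (option bool) * seq (option bool)) :=
  let: (l, r) := t in
  match mv with
  | None => (l, a :: behead r)
  | Some true => (a :: l, behead r)
  | Some false => (behead l, head None l :: a :: behead r)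
  end.

Definition step (M : itm) (c : config M) (coin : bool) : config M * bool :=
  let a := delta (state c) (ohead (incoming c)) (head None (work c).2) coin in
  (Config (next_ctrl a)
     (if consume a then behead (incoming c) else incoming c)
     (tape_step (write a) (head_move a) (work c))
     (if emit a is Some b then rcons (outgoing c) b else outgoing c),
   yield a).

Fixpoint run (R : realType) (M : itm) (fuel : nat) (c : config M) :
    dist R (config M) :=
  if fuel is fuel'.+1 then
    Flip 2^-1 (fun coin =>
      let: (c', stop) := step c coin in
      if stop then Ret c' else run R fuel' c')
  else Ret c.

(* One activation on message [msg], stopped after [clock] steps at the latest.
   PPT machines are represented as machines with a polynomial clock. *)
Definition activate (R : realType) (M : itm) (clock : nat) (c : config M)
    (msg : bitseq) : dist R (config M * bitseq) :=
  let* c' := run R clock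
    (Config (state c) (incoming c ++ msg) (work c) [::]) in
  Ret (c', outgoing c').

Record block (n : nat) := Block { miner : 'I_n; content : bitseq }.

(* Newest block first; the genesis block is left implicit. *)
Definition chain (n : nat) : Type := seq (block n).

(* [tree] lists all valid chains in order of creation; chains are referred to
   by their position in it, position 0 being the chain reduced to genesis.
   A successful query is the only way to add to [tree], so that nobody can
   forge a chain.  [local] gives the local chains, and [sent] the messages
   diffused in the current round by participants following the protocol. *)
Record world (n : nat) := World {
  tree : seq (chain n);
  local : 'I_n -> nat;
  sent : seq ('I_n * nat)
}.

Definition world0 (n : nat) : world n := World [:: [::]] (fun _ => 0%N) [::].

Definition chain_at (n : nat) (w : world n) (k : nat) : chain n :=
  nth [::] (tree w) k.

Definition local_chain (n : nat) (w : world n) (j : 'I_n) : chain n :=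
  chain_at w (local w j).

(* A success of [i] on chain [k], with content [x]. *)
Definition extend (n : nat) (w : world n) (i : 'I_n) (k : nat) (x : bitseq) :
    world n :=
  World (rcons (tree w) (Block i x :: chain_at w k)) (local w) (sent w).

Definition diffuse (n : nat) (w : world n) (i : 'I_n) (k : nat) : world n :=
  World (tree w) (local w) (rcons (sent w) (i, k)).

Definition chain_code (n : nat) (c : chain n) : bitseq :=
  encode (flatten [seq [:: bits (miner b); content b] | b <- c]).

(* All [q] queries try to extend the chain held at the beginning of the round.
   Only the first block found is sent; the others, which are never used, are
   not recorded.  The boolean tells whether a block was sent. *)
Definition protocol_turn (R : realType) (n q : nat) (p : R) (i : 'I_n)
    (x : bitseq) (w : world n) : dist R (world n * bool) :=
  let* answers := flips q p in
  Ret (if has id answers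
       then (diffuse (extend w i (local w i) x) i (size (tree w)), true)
       else (w, false)).

(* Position of the longest among the current chain [k] and the chains received
   [ks] (in order of reception); the earliest one in case of a tie. *)
Definition adopt (n : nat) (w : world n) (k : nat) (ks : seq nat) : nat :=
  foldl (fun k1 k2 =>
    if (size (chain_at w k1) < size (chain_at w k2))%N then k2 else k1) k ks.

(* [leak i x k k'] informs the adversary that the honest participant [i]
   diffuses chain [k'], which extends [k] by a block with content [x].
   [turn i x] is what happens when the environment activates the controlled
   participant [i] with input [x]; it yields the output to the environment.
   [deliver j] chooses the chains delivered to [j] before the messages of the
   participants following the protocol. *)
Record adversary (R : realType) (n : nat) := Adversary {
  mem : Type;
  mem0 : nat -> mem;
  leak : nat -> 'I_n -> bitseq -> nat -> nat -> mem -> dist R mem;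
  turn : nat -> 'I_n -> bitseq -> world n -> mem ->
           dist R (world n * mem * bitseq);
  deliver : nat -> 'I_n -> world n -> mem -> dist R (mem * seq nat)
}.

(* The adversary H_T. *)
Definition compliant (R : realType) (n q : nat) (p : R) (T : {set 'I_n}) :
    adversary R n :=
  @Adversary R n unit (fun _ => tt)
    (fun _ _ _ _ _ m => Ret m)
    (fun _ i x w m =>
       let* (w', _) := protocol_turn q p i x w in
       Ret (w', m, chain_code (local_chain w i)))
    (fun _ j w m => Ret (m, [seq s.2 | s <- sent w & s.1 \in T])).

(* What a deviating machine is told: an input from the environment to a
   controlled participant; a diffused message (sender, chain extended, new
   chain, content); a request for the next query of a controlled participant
   (chain to extend, content); the answer to it (success, position of the chain
   so obtained); a request for the output of a controlled participant to the
   environment; a request for the list of chains to deliver to a participant. *)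
Definition input_code (n : nat) (i : 'I_n) (x : bitseq) : bitseq :=
  encode [:: bits 0; bits i; x].
Definition leak_code (n : nat) (i : 'I_n) (k k' : nat) (x : bitseq) : bitseq :=
  encode [:: bits 1; bits i; bits k; bits k'; x].
Definition query_code (n : nat) (i : 'I_n) : bitseq :=
  encode [:: bits 2; bits i].
Definition answer_code (n : nat) (i : 'I_n) (b : bool) (k : nat) : bitseq :=
  encode [:: bits 3; bits i; [:: b]; bits k].
Definition output_code (n : nat) (i : 'I_n) : bitseq :=
  encode [:: bits 4; bits i].
Definition deliver_code (n : nat) (j : 'I_n) : bitseq :=
  encode [:: bits 5; bits j].

(* [k] adaptive queries by the controlled participant [i].  A position that is
   not in [tree] stands for the chain reduced to genesis. *)
Fixpoint machine_queries (R : realType) (n : nat) (p : R) (M : itm)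
    (clock k : nat) (i : 'I_n) (w : world n) (m : config M) :
    dist R (world n * config M) :=
  if k is k'.+1 then
    let* (m1, out) := activate R clock m (query_code i) in
    let fields := decode out in
    let parent := nat_of_bits (nth [::] fields 0) in
    let* b := Flip p (fun b => Ret b) in
    let* (m2, _) := activate R clock m1 (answer_code i b (size (tree w))) in
    machine_queries p clock k'
      i (if b then extend w i parent (nth [::] fields 1) else w) m2
  else Ret (w, m).

(* The static adversary with fixed cost run by [M]: the controlled participant
   [i] asks [q - cost i] queries in every round. *)
Definition fixed_cost (R : realType) (n q : nat) (p : R) (M : itm)
    (clock : nat -> nat) (cost : 'I_n -> nat) : adversary R n :=
  @Adversary R n (config M) (fun kappa => config0 M kappa)
    (fun kappa i x k k' m =>
       let* (m', _) := activate R (clock kappa) m (leak_code i k k' x) in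
       Ret m')
    (fun kappa i x w m =>
       let* (m1, _) := activate R (clock kappa) m (input_code i x) in
       let* (w', m2) :=
         machine_queries p (clock kappa) (q - cost i) i w m1 in
       let* (m3, out) := activate R (clock kappa) m2 (output_code i) in
       Ret (w', m3, out))
    (fun kappa j _ m =>
       let* (m', out) := activate R (clock kappa) m (deliver_code j) in
       Ret (m', map nat_of_bits (decode out))).

(* A machine with input 1^(zinput kappa), run for [zrounds kappa] rounds. *)
Record environment := Environment {
  zmachine : itm;
  zinput : nat -> nat;
  zclock : nat -> nat;
  zrounds : nat -> nat
}.

Definition admissible (r : nat -> nat) (Z : environment) : Prop :=
  [/\ polynomial (zinput Z), polynomial (zclock Z),
      forall kappa, zrounds Z kappa = r kappa,
      nonconstant_polynomial r
    & forall kappa, (0 < kappa)%N -> r kappa <> 0%N].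

Section Execution.
Variables (R : realType) (n q : nat) (p : R).
Variables (Z : environment) (T : {set 'I_n}) (A : adversary R n).
Variable kappa : nat.

Record global := Global {
  wd : world n;
  zcfg : config (zmachine Z);
  zmsg : bitseq;         (* output of the last activated participant *)
  amem : mem A
}.

Definition global0 : global :=
  Global (world0 n) (config0 (zmachine Z) (zinput Z kappa)) [::]
    (mem0 A kappa).

Definition activation (i : 'I_n) (g : global) : dist R global :=
  let* (z, x) :=
    activate R (zclock Z (zinput Z kappa)) (zcfg g) (frame (zmsg g)) in
  if i \in T then
    let* (w, m, out) := turn kappa i x (wd g) (amem g) in
    Ret (Global w z out m)
  else
    let w := wd g in
    let* (w', found) := protocol_turn q p i x w in
    let* m :=
      if found then leak kappa i x (local w i) (size (tree w)) (amem g)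
      else Ret (amem g) in
    Ret (Global w' z (chain_code (local_chain w i)) m).

Fixpoint activations (s : seq 'I_n) (g : global) : dist R global :=
  if s is i :: s' then let* g' := activation i g in activations s' g'
  else Ret g.

(* Each [j] receives the chains chosen by the adversary, and then all the
   messages of the round (including its own). *)
Fixpoint deliveries (s : seq 'I_n) (w : world n) (m : mem A)
    (loc : 'I_n -> nat) : dist R (('I_n -> nat) * mem A) :=
  if s is j :: s' then
    let* (m', ks) := deliver kappa j w m in
    let k := adopt w (local w j) (ks ++ map snd (sent w)) in
    deliveries s' w m' (fun i => if i == j then k else loc i)
  else Ret (loc, m).

Definition round (g : global) : dist R global :=
  let* g1 := activations (enum 'I_n) g in
  let w := wd g1 in
  let* (loc, m) := deliveries (enum 'I_n) w (amem g1) (local w) in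
  Ret (Global (World (tree w) loc [::]) (zcfg g1) (zmsg g1) m).

Fixpoint rounds (k : nat) (g : global) : dist R global :=
  if k is k'.+1 then let* g' := round g in rounds k' g' else Ret g.

Definition execution : dist R (world n) :=
  let* g := rounds (zrounds Z kappa) global0 in Ret (wd g).

End Execution.

(* The utility U^j_T of an execution, for [j] outside [T]. *)
Definition utility (R : realType) (n : nat) : Type :=
  {set 'I_n} -> 'I_n -> world n -> R.

(* The value 0 is a dummy for an empty range. *)
Definition Umax (R : realType) (n : nat) (U : utility R n) (T : {set 'I_n})
    (e : world n) : R :=
  if [pick j | j \notin T] is Some j0
  then \big[Num.max/U T j0 e]_(j | j \notin T) U T j e else 0.

Definition Umin (R : realType) (n : nat) (U : utility R n) (T : {set 'I_n})
    (e : world n) : R :=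
  if [pick j | j \notin T] is Some j0
  then \big[Num.min/U T j0 e]_(j | j \notin T) U T j e else 0.

Definition EVP (R : realType) (n q : nat) (p : R) (t : nat) (eps eps' : R)
    (U : utility R n) : Prop :=
  forall (T : {set 'I_n}) (cost : 'I_n -> nat) (M : itm) (clock : nat -> nat)
         (Z : environment) (r : nat -> nat),
    (#|T| <= t)%N ->
    (forall i, i \in T -> (cost i <= q)%N) ->
    polynomial clock ->
    admissible r Z ->
    negligible (fun kappa =>
      Pr (independent_pair
            (execution q p Z T (fixed_cost q p M clock cost) kappa)
            (execution q p Z T (compliant q p T) kappa))
         (fun e => ~~ (Umax U T e.1
                       <= Umin U T e.2 + eps * `|Umin U T e.2| + eps'))).

(* R^j_T, for a given reward of each block. *)
Definition total_reward (R : realType) (n : nat) (reward : block n -> R) :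
    utility R n :=
  fun T j e => \sum_(b <- local_chain e j | miner b \in T) reward b.

(* Main.v *)
Require Import Defs.
From mathcomp Require Import all_boot all_order all_algebra.
From mathcomp Require Import reals sequences exp.
From mathcomp Require polyrcf.
From mathcomp Require Import zify ring lra.

Import Order.TTheory GRing.Theory Num.Theory.
Local Open Scope ring_scope.

(** Let [m = q #|T|].  However a deviating adversary plays, the number [V] of
    its blocks in any chain is at most its number of successful queries, so
    [E a^V <= (1 + p (a - 1))^(m r)] for [a >= 1].  When [T] complies, all
    participants hold the same chain, and the number [C] of blocks of [T] in it
    grows by one in each round where [T] succeeds at least once, so
    [E b^C <= (1 - P (1 - b))^r] for [b <= 1], with
    [P = 1 - (1 - p)^m >= m p / (1 + m p)].  Since [m p <= P (1 + s)], and
    [c = 1 + eps] exceeds [1 + s], a Chernoff bound with [a = e^l] and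
    [b = e^(- l c)] for small [l] shows that [V > c C] has probability at most
    [e^(- gamma r)], for some [gamma > 0]. *)

(** * Expectations *)

Fixpoint expect {R : realType} {A : Type} (d : dist R A) (f : A -> R) : R :=
  match d with
  | Ret x => f x
  | Flip a k => a * expect (k true) f + (1 - a) * expect (k false) f
  end.

(* Also requires the biases of all coins of [d] to be probabilities. *)
Fixpoint always {R : realType} {A : Type} (P : A -> Prop) (d : dist R A) :
    Prop :=
  match d with
  | Ret x => P x
  | Flip a k => 0 <= a <= 1 /\ forall b, always P (k b)
  end.

(** What remains of [always] is the condition on the biases, which makes [expect] monotone. *)
Definition valid {R : realType} {A : Type} (d : dist R A) : Prop :=
  always (fun _ => True) d.

Section Expectation.
Context {R : realType}.

Lemma PrE {A : Type} (d : dist R A) (E : A -> bool) :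
  Pr d E = expect d (fun x => (E x)%:R).
Proof. by elim: d => [//|a k IH] /=; rewrite !IH. Qed.

Lemma eq_expect {A : Type} (d : dist R A) (f g : A -> R) :
  f =1 g -> expect d f = expect d g.
Proof. by move=> fg; elim: d => [x|a k IH] /=; rewrite ?fg ?IH. Qed.

Lemma expect_bind {A B : Type} (d : dist R A) (h : A -> dist R B) f :
  expect (bind d h) f = expect d (fun x => expect (h x) f).
Proof. by elim: d => [//|a k IH] /=; rewrite !IH. Qed.

Lemma expect_const {A : Type} (d : dist R A) (c : R) :
  expect d (fun _ => c) = c.
Proof. by elim: d => [//|a k IH] /=; rewrite !IH; ring. Qed.

Lemma expectZ {A : Type} (d : dist R A) (c : R) f :
  expect d (fun x => c * f x) = c * expect d f.
Proof. by elim: d => [//|a k IH] /=; rewrite !IH; ring. Qed.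

Lemma expectB {A : Type} (d : dist R A) f g :
  expect d (fun x => f x - g x) = expect d f - expect d g.
Proof. by elim: d => [//|a k IH] /=; rewrite !IH; ring. Qed.

Lemma expect_independent_pair {A B : Type} (d : dist R A) (e : dist R B) f g :
  expect (independent_pair d e) (fun x => f x.1 * g x.2) =
  expect d f * expect e g.
Proof.
rewrite /independent_pair expect_bind mulrC -expectZ; apply: eq_expect => x.
by rewrite expect_bind /= expectZ mulrC.
Qed.

Lemma always_imp {A : Type} (P Q : A -> Prop) (d : dist R A) :
  (forall x, P x -> Q x) -> always P d -> always Q d.
Proof.
move=> PQ; elim: d => [x|a k IH] /=; first exact: PQ.
by case=> a01 kP; split=> // b; apply: IH.
Qed.

Lemma always_bind {A B : Type} (P : A -> Prop) (Q : B -> Prop) (d : dist R A)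
    (h : A -> dist R B) :
  always P d -> (forall x, P x -> always Q (h x)) -> always Q (bind d h).
Proof.
move=> dP hQ; elim: d dP => [x|a k IH] /=; first exact: hQ.
by case=> a01 kP; split=> // b; apply: IH.
Qed.

Lemma always_valid_bind {A B : Type} (Q : B -> Prop) (d : dist R A)
    (h : A -> dist R B) :
  valid d -> (forall x, always Q (h x)) -> always Q (bind d h).
Proof. by move=> dV hQ; apply: always_bind dV _ => x _. Qed.

Lemma ler_expect {A : Type} (P : A -> Prop) (d : dist R A) f g :
  always P d -> (forall x, P x -> f x <= g x) -> expect d f <= expect d g.
Proof.
move=> dP fg; elim: d dP => [x|a k IH] /=; first exact: fg.
case=> /andP[a0 a1] kP; apply: lerD; apply: ler_wpM2l; rewrite ?subr_ge0 //.
  exact: IH.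
exact: IH.
Qed.

(** The basic move of the moment computations: the conditional expectation of the continuation is
    replaced by a bound [g], valid on an invariant [P] of the first stage. *)
Lemma expect_bind_le {A B : Type} (P : A -> Prop) (d : dist R A)
    (h : A -> dist R B) f g :
  always P d -> (forall x, P x -> expect (h x) f <= g x) ->
  expect (bind d h) f <= expect d g.
Proof. by move=> dP fg; rewrite expect_bind; apply: ler_expect dP fg. Qed.

Lemma expect_valid_bind_le {A B : Type} (d : dist R A) (h : A -> dist R B) f c :
  valid d -> (forall x, expect (h x) f <= c) -> expect (bind d h) f <= c.
Proof.
move=> dV fc; rewrite -[leRHS](expect_const d).
by apply: expect_bind_le dV _ => x _.
Qed.

Lemma always_independent_pair {A B : Type} (P : A -> Prop) (Q : B -> Prop)
    (d : dist R A) (e : dist R B) :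
  always P d -> always Q e ->
  always (fun x => P x.1 /\ Q x.2) (independent_pair d e).
Proof.
by move=> dP eQ; apply: always_bind dP _ => x Px; apply: always_bind eQ _.
Qed.

Lemma valid_run (M : itm) k (c : config M) : valid (run R k c).
Proof.
elim: k c => [//|k IH] c /=; split; first lra.
by move=> b; case: ifP => // _; apply: IH.
Qed.

Lemma valid_activate (M : itm) k (c : config M) msg :
  valid (activate R k c msg).
Proof. by apply: always_valid_bind (valid_run _ _ _) _ => c'. Qed.

Context {p : R} (hp : 0 <= p <= 1).

Lemma valid_flips k : valid (flips k p).
Proof.
by elim: k => [//|k IH] /=; split=> // b /=; apply: always_valid_bind IH _.
Qed.

Lemma expect_flips_has k (h : bool -> R) :
  expect (flips k p) (fun s => h (has id s)) =
  (1 - (1 - p) ^+ k) * h true + (1 - p) ^+ k * h false.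
Proof.
elim: k => [|k IH]; first by rewrite /= expr0; ring.
rewrite /= !expect_bind /= expect_const IH exprS; ring.
Qed.

Definition mine {n} (i : 'I_n) x (w : world n) : world n :=
  diffuse (extend w i (local w i) x) i (size (tree w)).

Lemma always_protocol_turn {n} q i x (w : world n) P :
  P (mine i x w, true) -> P (w, false) ->
  always P (protocol_turn q p i x w).
Proof.
by move=> P1 P0; apply: always_valid_bind (valid_flips _) _ => s /=; case: ifP.
Qed.

Lemma expect_protocol_turn {n} q i x (w : world n) f :
  expect (protocol_turn q p i x w) f =
  (1 - (1 - p) ^+ q) * f (mine i x w, true) + (1 - p) ^+ q * f (w, false).
Proof.
rewrite expect_bind -(expect_flips_has q
  (fun b => f (if b then (mine i x w, true) else (w, false)))).
by apply: eq_expect => s /=; case: has.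
Qed.

Lemma always_rounds {n q} {Z : environment} {T : {set 'I_n}}
    {A : adversary R n} {kappa} (I : global Z A -> Prop) k g :
  (forall g, I g -> always I (round q p T kappa g)) -> I g ->
  always I (rounds q p T kappa k g).
Proof.
move=> IA; elim: k g => [//|k IH] g Ig /=.
exact: always_bind (IA _ Ig) _.
Qed.

(** Supermartingale-style compounding of a one-round bound, where [I] confines that bound to the
    states that occur between rounds. *)
Lemma rounds_moment {n q} {Z : environment} {T : {set 'I_n}}
    {A : adversary R n} {kappa} (I : global Z A -> Prop) f rho k g :
  0 <= rho -> (forall g, I g -> always I (round q p T kappa g)) ->
  (forall g, I g -> expect (round q p T kappa g) f <= rho * f g) -> I g ->
  expect (rounds q p T kappa k g) f <= rho ^+ k * f g.
Proof.
move=> rho0 IA If; elim: k g => [|k IH] g Ig /=; first by rewrite expr0 mul1r.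
apply: le_trans
  (expect_bind_le _ _ _ _ (fun g => rho ^+ k * f g) (IA _ Ig) IH) _.
by rewrite expectZ exprSr -mulrA ler_wpM2l ?exprn_ge0 ?If.
Qed.

End Expectation.

(** * The deviating execution *)

Definition mined {n} (T : {set 'I_n}) (c : chain n) : nat :=
  count (fun b => miner b \in T) c.

(** Taking all chains ever created, abandoned ones included, gives a potential that dominates every
    local chain whatever is delivered to whom, and that only a success of [T] can raise. *)
Definition most_mined {n} (T : {set 'I_n}) (w : world n) : nat :=
  \max_(c <- tree w) mined T c.

(** A position outside [tree], which a deviating machine may name as parent, reads as genesis and
    counts 0. *)
Lemma mined_chain_at {n} (T : {set 'I_n}) (w : world n) k :
  (mined T (chain_at w k) <= most_mined T w)%N.
Proof.
rewrite /chain_at /most_mined; elim: (tree w) k => [|c s IH] k.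
  by rewrite nth_nil.
by rewrite big_cons leq_max; case: k => [|k] /=; rewrite ?leqnn ?IH ?orbT.
Qed.

Lemma most_mined_extend {n} (T : {set 'I_n}) (w : world n) i k x :
  (most_mined T (extend w i k x) <= most_mined T w + (i \in T))%N.
Proof.
rewrite /most_mined /= big_rcons /= -/(most_mined T w) geq_max.
by rewrite leq_addr [leqRHS]addnC leq_add2l mined_chain_at.
Qed.

Lemma count_mem_enum {I : finType} (T : {set I}) :
  count (mem T) (enum I) = #|T|.
Proof. by rewrite [RHS]cardE [in RHS]/enum_mem size_filter -enumT. Qed.

Section Adversary.
Context {R : realType} {n q : nat} {p : R} {T : {set 'I_n}} {M : itm}
  {clock : nat -> nat} {cost : 'I_n -> nat} {Z : environment} {a : R}
  {kappa : nat} (hp : 0 <= p <= 1) (ha : 1 <= a).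

Local Notation A := (fixed_cost q p M clock cost).

Lemma valid_machine_queries t k (i : 'I_n) w (m : config M) :
  valid (machine_queries p t k i w m).
Proof.
elim: k w m => [//|k IH] w m /=.
apply: always_valid_bind (valid_activate _ _ _ _) _ => -[m1 out] /=.
split=> // b; apply: always_valid_bind (valid_activate _ _ _ _) _ => -[m2 _].
exact: IH.
Qed.

Lemma query_moment_ge1 : 1 <= 1 + p * (a - 1).
Proof. by case/andP: hp => p0 _; rewrite lerDl mulr_ge0 ?subr_ge0. Qed.

(** The queries are adaptive, but each coin is fresh: whatever parent is chosen, the potential grows
    by at most one with probability [p], at a factor [p * a + (1 - p)] per query. *)
Lemma machine_queries_moment t k (i : 'I_n) w (m : config M) : i \in T ->
  expect (machine_queries p t k i w m) (fun y => a ^+ most_mined T y.1) <=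
  (1 + p * (a - 1)) ^+ k * a ^+ most_mined T w.
Proof.
move=> iT; have a0 : 0 <= a by apply: le_trans ha.
have z0 : 0 <= 1 + p * (a - 1) by apply: le_trans query_moment_ge1.
elim: k w m => [|k IH] w m /=; first by rewrite mul1r.
apply: expect_valid_bind_le (valid_activate _ _ _ _) _ => -[m1 out] /=.
set w1 := extend _ _ _ _.
(* Both answers are treated at once: the answer [b] costs a factor [a ^+ b], to be averaged over the
   coin afterwards. *)
have E b : expect
    (let* (m2, _) := activate R t m1 (answer_code i b (size (tree w))) in
     machine_queries p t k i (if b then w1 else w) m2)
    (fun y => a ^+ most_mined T y.1)
    <= (1 + p * (a - 1)) ^+ k * (a ^+ b * a ^+ most_mined T w).
  apply: expect_valid_bind_le (valid_activate _ _ _ _) _ => -[m2 _].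
  apply: le_trans (IH _ _) _; rewrite ler_wpM2l ?exprn_ge0 // -exprD.
  rewrite ler_weXn2l //; case: b; last by rewrite add0n.
  by rewrite addnC; have := most_mined_extend T w i _ _; rewrite iT; apply.
case/andP: hp => p0 p1.
apply: le_trans (lerD (ler_wpM2l p0 (E true)) (ler_wpM2l _ (E false))) _.
  by rewrite subr_ge0.
by rewrite exprS expr1 expr0 le_eqVlt; apply/orP; left; apply/eqP; ring.
Qed.

Lemma activation_moment (i : 'I_n) (g : global Z A) :
  expect (activation q p T kappa i g) (fun g => a ^+ most_mined T (wd g)) <=
  (1 + p * (a - 1)) ^+ (q * (i \in T)) * a ^+ most_mined T (wd g).
Proof.
have a0 : 0 <= a by apply: le_trans ha.
have z1 := query_moment_ge1.
have z0 : 0 <= 1 + p * (a - 1) by apply: le_trans z1.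
apply: expect_valid_bind_le (valid_activate _ _ _ _) _ => -[z x].
case: ifPn => iT /=.
  rewrite expect_bind; apply: expect_valid_bind_le (valid_activate _ _ _ _) _.
  move=> -[m1 _]; rewrite -expect_bind.
  set g0 := (fun y => a ^+ _).
  (* The factor per query is at least 1, so the bound for [q - cost i] queries is at most the one
     for [q]. *)
  have E : expect (machine_queries p (clock kappa) (q - cost i) i (wd g) m1)
    (fun y => a ^+ most_mined T y.1) <=
    (1 + p * (a - 1)) ^+ (q * 1) * a ^+ most_mined T (wd g).
    apply: le_trans (machine_queries_moment _ _ _ _ _ iT) _.
    by rewrite ler_wpM2r ?exprn_ge0 // ler_weXn2l // muln1 leq_subr.
  apply: le_trans E; rewrite !expect_bind.
  apply: ler_expect (valid_machine_queries _ _ _ _ _) _ => -[w' m2] _ /=.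
  rewrite expect_bind.
  by rewrite (eq_expect _ _ (fun _ => a ^+ most_mined T w')) ?expect_const //;
    case.
(* For an honest [i], a new chain has the same count as its parent, so the potential does not grow
   in either outcome. *)
rewrite muln0 expr0 mul1r.
rewrite -[leRHS](expect_const (protocol_turn q p i x (wd g))).
apply: (expect_bind_le
  (fun y => most_mined T y.1 <= most_mined T (wd g))%N).
  apply: (always_protocol_turn hp) => //=.
  have := most_mined_extend T (wd g) i (local (wd g) i) x.
  by rewrite (negPf iT) addn0.
move=> [w' found] /= w'le; rewrite expect_bind.
rewrite (eq_expect _ _ (fun _ => a ^+ most_mined T w')) ?expect_const //.
by rewrite ler_weXn2l.
Qed.

Lemma valid_activation (i : 'I_n) (g : global Z A) :
  valid (activation q p T kappa i g).
Proof.
apply: always_valid_bind (valid_activate _ _ _ _) _ => -[z x].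
case: ifP => _ /=.
  apply: always_valid_bind; last by case=> -[].
  apply: always_valid_bind (valid_activate _ _ _ _) _ => -[m1 _].
  apply: always_valid_bind (valid_machine_queries _ _ _ _ _) _ => -[w m2].
  by apply: always_valid_bind (valid_activate _ _ _ _) _ => -[].
apply: always_valid_bind; first exact: always_protocol_turn.
move=> [w found]; apply: always_valid_bind => //; case: found => //.
by apply: always_valid_bind (valid_activate _ _ _ _) _ => -[].
Qed.

Lemma valid_activations s (g : global Z A) :
  valid (activations q p T kappa s g).
Proof.
elim: s g => [//|i s IH] g /=.
exact: always_valid_bind (valid_activation _ _) _.
Qed.

Lemma activations_moment s (g : global Z A) :
  expect (activations q p T kappa s g) (fun g => a ^+ most_mined T (wd g)) <=
  (1 + p * (a - 1)) ^+ (q * count (mem T) s) * a ^+ most_mined T (wd g).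
Proof.
have z0 : 0 <= 1 + p * (a - 1) by apply: le_trans query_moment_ge1.
elim: s g => [|i s IH] g /=; first by rewrite muln0 mul1r.
apply: le_trans (expect_bind_le _ _ _ _ _ (valid_activation _ _)
  (fun g _ => IH g)) _.
rewrite expectZ addnC mulnDr exprD -mulrA.
by rewrite ler_wpM2l ?exprn_ge0 // activation_moment.
Qed.

Lemma valid_deliveries s w m loc :
  valid (deliveries (A := A) kappa s w m loc).
Proof.
elim: s m loc => [//|j s IH] m loc /=.
apply: always_valid_bind; last by case=> m1 ks; apply: IH.
by apply: always_valid_bind (valid_activate _ _ _ _) _ => -[].
Qed.

Lemma valid_round (g : global Z A) : valid (round q p T kappa g).
Proof.
apply: always_valid_bind (valid_activations _ _) _ => g1.
by apply: always_valid_bind (valid_deliveries _ _ _ _) _ => -[].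
Qed.

Lemma round_moment (g : global Z A) :
  expect (round q p T kappa g) (fun g => a ^+ most_mined T (wd g)) <=
  (1 + p * (a - 1)) ^+ (q * #|T|) * a ^+ most_mined T (wd g).
Proof.
rewrite -count_mem_enum; apply: le_trans (activations_moment (enum 'I_n) g).
apply: expect_bind_le (valid_activations _ _) _ => g1 _.
(* Deliveries leave [tree], hence the potential, unchanged. *)
by apply: expect_valid_bind_le (valid_deliveries _ _ _ _) _ => -[].
Qed.

Lemma valid_execution : valid (execution q p Z T A kappa).
Proof.
apply: (always_valid_bind _ _ _ (always_rounds (fun _ => True) _ _ _ _)) => //.
by move=> g _; apply: valid_round.
Qed.

Lemma execution_moment :
  expect (execution q p Z T A kappa) (fun w => a ^+ most_mined T w) <=
  ((1 + p * (a - 1)) ^+ (q * #|T|)) ^+ zrounds Z kappa.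
Proof.
have z0 : 0 <= 1 + p * (a - 1) by apply: le_trans query_moment_ge1.
rewrite /execution expect_bind /=.
apply: le_trans (rounds_moment (fun _ => True) _ _ _ _ (exprn_ge0 _ z0)
  (fun g _ => valid_round g) (fun g _ => round_moment g) I) _.
by rewrite /most_mined /= big_seq1 expr0 mulr1.
Qed.

End Adversary.

(** * The compliant execution *)

(* Mid-round state of a world in which everybody extends the chain [c], held at
   position [k]. *)
Definition in_step {n} (T : {set 'I_n}) (k : nat) (c : chain n) (w : world n) :
    Prop :=
  [/\ forall i, local w i = k, (k < size (tree w))%N, chain_at w k = c
    & forall t, t \in sent w ->
      [/\ (t.2 < size (tree w))%N, size (chain_at w t.2) = (size c).+1
        & mined T (chain_at w t.2) = ((t.1 \in T) + mined T c)%N]].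

(** The invariant at round boundaries. It compares positions in [tree], which is stronger than
    equality of the chains held there. *)
Definition synchronized {n} (w : world n) : Prop :=
  [/\ forall i j, local w i = local w j,
      forall i, (local w i < size (tree w))%N & sent w = [::]].

Lemma chain_at_extend {n} (w : world n) i k x l : (l < size (tree w))%N ->
  chain_at (extend w i k x) l = chain_at w l.
Proof. by move=> lw; rewrite /chain_at nth_rcons lw. Qed.

(** Local chains do not move during a round, so each new block extends the same [c]; appending to
    [tree] keeps the older positions intact. *)
Lemma in_step_mine {n} (T : {set 'I_n}) k c i x (w : world n) :
  in_step T k c w -> in_step T k c (mine i x w).
Proof.
move=> [loc kw ck st]; split=> //=.
- by rewrite size_rcons ltnW.
- by rewrite -ck -[RHS](chain_at_extend w i (local w i) x).
move=> t; rewrite mem_rcons inE => /predU1P[->|tw] /=.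
  rewrite size_rcons ltnS leqnn.
  have -> : chain_at (mine i x w) (size (tree w)) = Block i x :: c.
    by rewrite /chain_at nth_rcons ltnn eqxx loc ck.
  by [].
have [tw1 tw2 tw3] := st t tw.
have E : chain_at (mine i x w) t.2 = chain_at w t.2.
  exact: (chain_at_extend w i (local w i) x).
by rewrite E size_rcons ltnW.
Qed.

(** The first chain received beats the current one, and all later ones only tie with it. *)
Lemma adopt_longest {n} (w : world n) k l :
  (forall k', k' \in l -> size (chain_at w k') = (size (chain_at w k)).+1) ->
  adopt w k l = head k l.
Proof.
case: l => [//|k1 l] kl /=; rewrite /adopt /= (kl k1) ?mem_head // ltnSn.
have {}kl k' : k' \in l -> size (chain_at w k') = size (chain_at w k1).
  by move=> k'l; rewrite (kl k') ?(kl k1) ?inE ?k'l ?eqxx ?orbT.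
elim: l kl => [//|k2 l IH] kl /=; rewrite kl ?mem_head // ltnn.
by apply: IH => k' k'l; rewrite (kl k') // inE k'l orbT.
Qed.

Definition found_by {n} (T : {set 'I_n}) (w : world n) : bool :=
  has (fun t => t.1 \in T) (sent w).

Section Compliant.
Context {R : realType} {n q : nat} {p : R} {T : {set 'I_n}} {Z : environment}
  {b : R} {kappa : nat} (hp : 0 <= p <= 1) (hb : 0 <= b <= 1).

Local Notation H := (compliant q p T).

Lemma activation_in_step k c i (g : global Z H) : in_step T k c (wd g) ->
  always (fun g => in_step T k c (wd g)) (activation q p T kappa i g).
Proof.
move=> Ig; apply: always_valid_bind (valid_activate _ _ _ _) _ => -[z x].
have W : always (fun y => in_step T k c y.1) (protocol_turn q p i x (wd g)).
  by apply: (always_protocol_turn hp) => //; apply: in_step_mine.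
case: ifP => _ /=.
  apply: (always_bind (fun y => in_step T k c y.1.1)); last by case=> -[].
  by apply: always_bind W _; case.
by apply: always_bind W _ => -[w []].
Qed.

Lemma activations_in_step k c s (g : global Z H) : in_step T k c (wd g) ->
  always (fun g => in_step T k c (wd g)) (activations q p T kappa s g).
Proof.
elim: s g => [//|i s IH] g Ig /=.
exact: always_bind (activation_in_step _ _ _ _ Ig) _.
Qed.

Lemma found_by_mine i x (w : world n) :
  found_by T (mine i x w) = (i \in T) || found_by T w.
Proof. by rewrite /found_by /= has_rcons. Qed.

(** An arbitrary [f] lets the induction over activations feed its own conclusion back in as a new
    test function. *)
Lemma expect_activation i (g : global Z H) (f : bool -> R) :
  expect (activation q p T kappa i g) (fun g => f (found_by T (wd g))) =
  (1 - (1 - p) ^+ q) * f ((i \in T) || found_by T (wd g)) +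
  (1 - p) ^+ q * f (found_by T (wd g)).
Proof.
rewrite expect_bind.
rewrite -[RHS](expect_const
  (activate R (zclock Z (zinput Z kappa)) (zcfg g) (frame (zmsg g)))).
apply: eq_expect => -[z x].
have E : expect (protocol_turn q p i x (wd g)) (fun y => f (found_by T y.1)) =
  (1 - (1 - p) ^+ q) * f ((i \in T) || found_by T (wd g)) +
  (1 - p) ^+ q * f (found_by T (wd g)).
  by rewrite expect_protocol_turn /= found_by_mine.
by rewrite -E; case: ifP => _ /=; rewrite !expect_bind;
  apply: eq_expect => s /=; case: has.
Qed.

(** [Q] is the probability that every query of [T] in [s] fails; one success sets the flag for good,
    and successes outside [T] leave it alone. *)
Lemma expect_activations s (g : global Z H) (f : bool -> R) :
  expect (activations q p T kappa s g) (fun g => f (found_by T (wd g))) =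
  let Q := (1 - p) ^+ (q * count (mem T) s) in
  (1 - Q) * f true + Q * f (found_by T (wd g)).
Proof.
elim: s g => [|i s IH] g /=; first by rewrite muln0 expr0; ring.
rewrite expect_bind; set Q := (1 - p) ^+ (q * count (mem T) s).
rewrite (eq_expect _ _ _ IH).
rewrite (expect_activation _ _ (fun b => (1 - Q) * f true + Q * f b)).
rewrite mulnDr exprD -/Q.
by case: (i \in T) => /=; rewrite ?muln1 ?muln0 ?expr0; ring.
Qed.

Lemma compliant_deliveries s w m loc :
  exists2 loc', deliveries (A := H) kappa s w m loc = Ret (loc', m) &
    forall j, j \in s -> loc' j = adopt w (local w j)
      ([seq t.2 | t <- sent w & t.1 \in T] ++ map snd (sent w)).
Proof.
(* The induction needs the value outside [s] too, since the accumulator [loc] is updated along the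
   way. *)
suff [loc' -> loc'E] : exists2 loc',
    deliveries (A := H) kappa s w m loc = Ret (loc', m) &
    forall j, loc' j = if j \in s then adopt w (local w j)
      ([seq t.2 | t <- sent w & t.1 \in T] ++ map snd (sent w)) else loc j.
  by exists loc' => // j js; rewrite loc'E js.
elim: s loc => [|i s IH] loc /=; first by exists loc.
have [loc' -> loc'E] := IH (fun j => if j == i then adopt w (local w i)
  ([seq t.2 | t <- sent w & t.1 \in T] ++ map snd (sent w)) else loc j).
exists loc' => // j; rewrite loc'E inE.
by case: (j \in s); rewrite ?orbT ?orbF //; case: eqP => // ->.
Qed.

(** Everybody starts from the same chain and receives the same list, so everybody adopts its first
    entry. As [T] delivers first, this entry is a block of [T] whenever [T] found one. *)
Lemma deliveries_synchronized k c w m : in_step T k c w ->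
  exists2 loc', deliveries (A := H) kappa (enum 'I_n) w m (local w) =
    Ret (loc', m) &
    let w' := World (tree w) loc' [::] in
    synchronized w' /\ forall j,
      (found_by T w + mined T c <= mined T (local_chain w' j))%N.
Proof.
move=> [loc kw ck st].
have [loc' -> loc'E] := compliant_deliveries (enum 'I_n) w m (local w).
exists loc' => //.
set l := _ ++ _ in loc'E.
have lsent k' : k' \in l -> exists2 t, t \in sent w & k' = t.2.
  rewrite mem_cat => /orP[] /mapP[t]; first rewrite mem_filter => /andP[_].
    by exists t.
  by exists t.
have {}loc'E j : loc' j = head k l.
  rewrite loc'E ?mem_enum // loc adopt_longest // => k' /lsent[t tw ->].
  by rewrite ck; have [] := st t tw.
have hd : head k l = k \/ exists2 t, t \in sent w & head k l = t.2.
  case: l lsent {loc'E} => [|k' l] lsent; [left|right] => //.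
  by apply: lsent; rewrite mem_head.
split; first split=> //= [i j|i]; first by rewrite !loc'E.
  rewrite loc'E; case: hd => [-> //|[t tw ->]].
  by have [] := st t tw.
move=> j; rewrite /local_chain /chain_at /= loc'E -/(chain_at w _).
have [fT|nfT] := boolP (found_by T w); last first.
  case: hd => [->|[t tw ->]]; first by rewrite ck.
  by have [_ _ ->] := st t tw; apply: leq_addl.
have /hasP[t0 t0w t0T] := fT.
(* The head of [l] comes from the messages of [T], a list that [t0] shows to be nonempty. *)
rewrite /l; case E: [seq t <- sent w | t.1 \in T] => [|t s].
  have : t0 \in [seq t <- sent w | t.1 \in T] by rewrite mem_filter t0T.
  by rewrite E.
have : t \in [seq t <- sent w | t.1 \in T] by rewrite E mem_head.
rewrite mem_filter => /andP[tT tw] /=.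
by have [_ _ ->] := st t tw; rewrite tT.
Qed.

Lemma synchronized_in_step j (w : world n) : synchronized w ->
  in_step T (local w j) (local_chain w j) w.
Proof. by case=> loc wlt st; split=> //; rewrite st. Qed.

Lemma synchronized_round (j : 'I_n) (g : global Z H) : synchronized (wd g) ->
  always (fun g => synchronized (wd g)) (round q p T kappa g).
Proof.
move=> /(synchronized_in_step j) Ig.
apply: always_bind (activations_in_step _ _ _ _ Ig) _ => g1 Ig1.
have [loc' E []] := deliveries_synchronized _ _ _ (amem g1) Ig1.
by cbv zeta; rewrite E.
Qed.

(** As [b <= 1], the lower bound on the new count gives an upper bound by
    [b ^+ mined T c * b ^+ found_by T (wd g)], where only the flag is random. *)
Lemma compliant_round_moment (j : 'I_n) (g : global Z H) :
  synchronized (wd g) ->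
  expect (round q p T kappa g)
    (fun g => b ^+ mined T (local_chain (wd g) j)) <=
  (1 - (1 - (1 - p) ^+ (q * #|T|)) * (1 - b)) *
    b ^+ mined T (local_chain (wd g) j).
Proof.
case/andP: (hb) => b0 b1 sg; have Ig := synchronized_in_step j _ sg.
set c := local_chain _ _ in Ig *.
apply: le_trans (expect_bind_le _ _ _ _
  (fun g => b ^+ mined T c * b ^+ found_by T (wd g))
  (activations_in_step _ _ _ _ Ig) _) _ => [g1 Ig1|].
  have [loc' E [_ /= cle]] := deliveries_synchronized _ _ _ (amem g1) Ig1.
  by cbv zeta; rewrite E /= -exprD ler_wiXn2l // addnC cle.
rewrite expectZ (expect_activations _ _ (fun x : bool => b ^+ x)).
case: sg => _ _ sg; rewrite /found_by sg /= expr1 expr0 -count_mem_enum.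
by rewrite le_eqVlt; apply/orP; left; apply/eqP; ring.
Qed.

Lemma synchronized0 : synchronized (world0 n).
Proof. by []. Qed.

Lemma synchronized_execution (j : 'I_n) :
  always synchronized (execution q p Z T H kappa).
Proof.
apply: (always_bind (fun g => synchronized (wd g))) => //.
by apply: always_rounds => // g; apply: synchronized_round.
Qed.

Lemma compliant_execution_moment (j : 'I_n) :
  expect (execution q p Z T H kappa)
    (fun w => b ^+ mined T (local_chain w j)) <=
  (1 - (1 - (1 - p) ^+ (q * #|T|)) * (1 - b)) ^+ zrounds Z kappa.
Proof.
case/andP: hb => b0 b1; case/andP: hp => p0 p1.
have Q0 : 0 <= (1 - p) ^+ (q * #|T|) by rewrite exprn_ge0 ?subr_ge0.
have Q1 : (1 - p) ^+ (q * #|T|) <= 1 by rewrite exprn_ile1 ?subr_ge0 ?gerBl.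
rewrite /execution expect_bind /=.
apply: le_trans (rounds_moment (fun g => synchronized (wd g)) _ _ _
  (global0 Z H kappa) _ (synchronized_round j) (compliant_round_moment j)
  synchronized0) _.
  by nra.
by rewrite /= expr0 mulr1.
Qed.

End Compliant.

(** * Asymptotics and the Chernoff bound *)

(** Growth is at least linear: with [P = Q * 'X + c] and [l] the leading coefficient of [Q],
    eventually [f k >= l * k - |c| >= l * k / 2]. *)
Lemma nonconstant_polynomial_growth (f : nat -> nat) :
  nonconstant_polynomial f ->
  exists D K : nat, forall k, (K <= k)%N -> (k <= D * f k)%N.
Proof.
case=> P [sP fP].
have P0 : P != 0 by rewrite -size_poly_gt0; apply: leq_trans sP.
have [lP|lP] : lead_coef P < 0 \/ 0 < lead_coef P.
- by apply/orP; rewrite -neq_lt lead_coef_eq0.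
(* A negative leading coefficient would make [P] negative at some positive integer, whereas [f]
   takes natural values. *)
- have [||y Py] := polyrcf.poly_lim_infty (p := - P) 1.
  + by rewrite lead_coefN oppr_gt0.
  + by rewrite size_polyN.
  have yk : y <= (Num.bound `|y|).+1%:R.
    apply: le_trans (ler_norm y) _.
    apply: le_trans (ltW (archi_boundP _)) _ => //.
    by rewrite ler_nat.
  have := Py _ yk; rewrite hornerN -fP //.
  by have := ler0n rat (f (Num.bound `|y|).+1); lra.
elim/poly_ind: P P0 sP fP lP => [|Q c _]; first by rewrite eqxx.
have [->|Q0] := eqVneq Q 0.
  by rewrite mul0r add0r size_polyC => _; case: eqP.
move=> _ sP fP; rewrite lead_coefDl ?lead_coefMX; last first.
  rewrite size_mulX // size_polyC; apply: leq_trans (leq_b1 _) _.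
  by rewrite size_poly_gt0.
set l := lead_coef Q => l0.
have [y Qy] : exists y : rat, forall x : rat, y <= x -> l <= Q.[x].
  exact: polyrcf.poly_pinfty_gt_lc.
have u0 : 0 <= 2 / l by rewrite divr_ge0 // ltW.
(* Beyond the first term [Q] is at least [l]; beyond the second, [|c|] is at most half of [l * k].
   The successor in the threshold below ensures [k > 0], where [f] and [P] agree. *)
pose z : rat := `|y| + 2 / l * `|c|.
have z0 : 0 <= z := addr_ge0 (normr_ge0 y) (mulr_ge0 u0 (normr_ge0 c)).
exists (Num.bound (2 / l)), (Num.bound z).+1 => k zk.
have kz : z <= k%:R.
  by apply: le_trans (ltW (archi_boundP z0)) _; rewrite ler_nat ltnW.
have k0 : (0 < k)%N by apply: leq_trans zk.
have yk : y <= k%:R.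
  apply: le_trans (ler_norm y) (le_trans _ kz).
  by rewrite lerDl (mulr_ge0 u0 (normr_ge0 c)).
have ck : 2 / l * `|c| <= k%:R by apply: le_trans kz; rewrite lerDr.
rewrite -(ler_nat rat) natrM.
apply: le_trans (ler_wpM2r (ler0n _ _) (ltW (archi_boundP u0))).
rewrite fP // hornerMXaddC.
have {}ck : 2 * `|c| <= k%:R * l by rewrite -ler_pdivrMr // mulrAC.
rewrite mulrAC ler_pdivlMr //.
have : l * k%:R <= Q.[k%:R] * k%:R by rewrite ler_wpM2r // Qy.
by have := ler_norm (- c); rewrite normrN; lra.
Qed.

(** The exponent is at least [gamma * k / D], and the exponential exceeds its Taylor term of degree
    [c.+1], one more than required, so that a factor [k] absorbs the constants. *)
Lemma negligible_exp {R : realType} (f : nat -> nat) (g : nat -> R) gamma :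
  0 < gamma -> nonconstant_polynomial f ->
  (forall k, 0 <= g k <= expR (- gamma) ^+ f k) -> negligible g.
Proof.
move=> gamma0 /nonconstant_polynomial_growth[D [K fK]] gf c.
(* The Taylor term equals [k ^+ c * (k * u)], so [k >= u^-1] suffices. *)
pose u : R := gamma ^+ c.+1 / (D%:R ^+ c.+1 * c.+1`!%:R).
exists (maxn K (Num.bound u^-1)) => k; rewrite geq_max => /andP[Kk uk] k0.
have kf := fK k Kk.
have D0 : (0 < D)%N by case: D kf {u uk fK} => // kf; lia.
have DR : 0 < D%:R :> R by rewrite ltr0n.
have kR : 0 < k%:R :> R by rewrite ltr0n.
have u0 : 0 < u by rewrite divr_gt0 ?mulr_gt0 ?exprn_gt0 // ltr0n fact_gt0.
case/andP: (gf k) => g0 gk; rewrite ger0_norm //; apply: le_lt_trans gk _.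
rewrite -expRM_natr mulNr expRN ltf_pV2 ?posrE ?expR_gt0 ?exprn_gt0 //.
have le1 : gamma * k%:R / D%:R <= gamma * (f k)%:R.
  by rewrite ler_pdivrMr // -mulrA ler_pM2l // mulrC -natrM ler_nat.
apply: lt_le_trans (_ : expR (gamma * k%:R / D%:R) <= _);
  last by rewrite ler_expR.
have x0 : 0 <= gamma * k%:R / D%:R.
  by rewrite mulr_ge0 ?mulr_ge0 ?invr_ge0 ?ler0n ?(ltW gamma0).
apply: lt_le_trans (expR_ge1Dxn c x0).
have -> : (gamma * k%:R / D%:R) ^+ c.+1 / c.+1`!%:R = k%:R ^+ c * (k%:R * u).
  rewrite /u !exprMn exprVn (exprSr k%:R); field.
  by rewrite !lt0r_neq0 ?exprn_gt0 ?ltr0n ?fact_gt0.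
have ku : 1 <= k%:R * u.
  rewrite -ler_pdivrMr // mul1r; apply: ltW.
  apply: lt_le_trans (archi_boundP _) _; first by rewrite invr_ge0 ltW.
  by rewrite ler_nat.
by rewrite ltr_pwDl // ler_peMr ?exprn_ge0.
Qed.

(** Induction works because [(1 - p) * (1 + (m + 1) * p) <= 1 + m * p]. This yields the lower bound
    on the probability of at least one success. *)
Lemma failure_bound {R : realType} (p : R) m : 0 <= p <= 1 ->
  (1 - p) ^+ m * (1 + m%:R * p) <= 1.
Proof.
case/andP=> p0 p1; elim: m => [|m IH]; first by rewrite expr0; lra.
apply: le_trans IH; rewrite exprSr -mulrA ler_wpM2l ?exprn_ge0 ?subr_ge0 //.
rewrite -natr1; have := ler0n R m; nra.
Qed.

(* First-order comparison at [l = 0]: the exponent of the left-hand side is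
   about [l * (m p - P c)], where [P >= m p / (1 + m p)] is the probability of
   at least one success among [m] queries. *)
Lemma moment_tradeoff {R : realType} (p c : R) m : 0 <= p <= 1 ->
  0 < m%:R * p -> 1 + m%:R * p < c ->
  exists l gamma : R, [/\ 0 < l, 0 < gamma &
    (1 + p * (expR l - 1)) ^+ m *
      (1 - (1 - (1 - p) ^+ m) * (1 - expR (- (l * c)))) <= expR (- gamma)].
Proof.
move=> p01; case/andP: (p01) => p0 p1; set th := m%:R * p => th0 thc.
have := failure_bound p m p01; rewrite -/th.
have : 0 <= (1 - p) ^+ m by rewrite exprn_ge0 ?subr_ge0.
set P := 1 - (1 - p) ^+ m.
have -> : (1 - p) ^+ m = 1 - P by rewrite /P; ring.
move=> P1 Pth.
have P0 : 0 < P by nra.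
have Pc : th < P * c by nra.
have c0 : 0 < c by lra.
(* Half of the value at which [th * (1 + l * c) = P * c * (1 - l)]; this makes [gamma] positive
   below. *)
pose l := (P * c - th) / (2 * c * (th + P)).
have d0 : 0 < 2 * c * (th + P) by rewrite !mulr_gt0 //; lra.
have lE : l * (2 * c * (th + P)) = P * c - th by rewrite divfK ?gt_eqF.
have l0 : 0 < l by rewrite divr_gt0 // subr_gt0.
have l1 : l < 1 by rewrite ltr_pdivrMr //; nra.
clearbody l.
(* This and [elc] are [expR l - 1 <= l / (1 - l)] and its counterpart for [- (l * c)], cleared of
   denominators; both follow from [1 + x <= expR x]. *)
have el : (expR l - 1) * (1 - l) <= l.
  have := expR_ge1Dx (- l); have := expRxMexpNx_1 l; have := expR_gt0 l.
  by nra.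
have elc : l * c <= (1 - expR (- (l * c))) * (1 + l * c).
  have := expR_ge1Dx (l * c); have := expRxMexpNx_1 (l * c).
  by have := expR_gt0 (- (l * c)); nra.
(* [- gamma] is the exponent obtained by applying [1 + x <= expR x] to each factor. *)
exists l, (P * (1 - expR (- (l * c))) - th * (expR l - 1)); split=> //.
  have lc : 0 < l * c by rewrite mulr_gt0.
  rewrite subr_gt0; apply: le_lt_trans (_ : th * (l / (1 - l)) < _).
    by rewrite ler_pM2l // ler_pdivlMr // subr_gt0.
  apply: lt_le_trans (_ : P * (l * c / (1 + l * c)) <= _); last first.
    by rewrite ler_pM2l // ler_pdivrMr //; lra.
  rewrite !mulrA ltr_pdivrMr ?subr_gt0 // [ltRHS]mulrAC.
  rewrite ltr_pdivlMr; last by lra.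
  have : th * (1 + l * c) < P * c * (1 - l) by nra.
  by rewrite -(ltr_pM2l l0); lra.
rewrite opprB expRD; apply: ler_pM.
- by rewrite exprn_ge0 // addr_ge0 // mulr_ge0 // subr_ge0 -expR0 ler_expR ltW.
- have := expR_gt0 (- (l * c)); nra.
- rewrite /th -mulrA expRM_natl lerXn2r ?nnegrE ?expR_ge0 ?expR_ge1Dx //.
  by rewrite addr_ge0 // mulr_ge0 // subr_ge0 -expR0 ler_expR ltW.
- exact: expR_ge1Dx.
Qed.

(** * From rewards to block counts, and the equilibrium *)

Lemma total_reward_const {R : realType} {n} (w : R) (T : {set 'I_n}) j e :
  total_reward (fun _ => w) T j e = w * (mined T (local_chain e j))%:R.
Proof.
rewrite /total_reward; elim: local_chain => [|x s IH].
  by rewrite big_nil mulr0.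
by rewrite big_cons IH /= natrD; case: (_ \in T); rewrite /=; ring.
Qed.

(** Synchronization makes the minimum the reward seen by any single [j], the potential bounds the
    maximum, and [w] cancels. The honest [j] excludes the dummy value 0 of [Umax] and [Umin]. *)
Lemma reward_gap {R : realType} {n} (w eps : R) (T : {set 'I_n}) j e e' :
  0 < w -> j \notin T -> synchronized e' ->
  ~~ (Umax (total_reward (fun _ => w)) T e <=
      Umin (total_reward (fun _ => w)) T e' +
      eps * `|Umin (total_reward (fun _ => w)) T e'| + 0) ->
  (1 + eps) * (mined T (local_chain e' j))%:R < (most_mined T e)%:R.
Proof.
move=> w0 jT [loc _ _]; rewrite -ltNge addr0.
have -> : Umin (total_reward (fun _ => w)) T e' =
    w * (mined T (local_chain e' j))%:R.
  rewrite /Umin; case: pickP => [j0 _|/(_ j)]; last by rewrite jT.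
  have E i : total_reward (fun _ => w) T i e' =
      w * (mined T (local_chain e' j))%:R.
    by rewrite total_reward_const /local_chain (loc i j).
  by apply: (big_ind (fun x => x = _)) => // x y -> ->; rewrite minxx.
have : Umax (total_reward (fun _ => w)) T e <= w * (most_mined T e)%:R.
  rewrite /Umax; case: pickP => [j0 _|/(_ j)]; last by rewrite jT.
  have E i : total_reward (fun _ => w) T i e <= w * (most_mined T e)%:R.
    by rewrite total_reward_const ler_pM2l // ler_nat mined_chain_at.
  by apply: (big_ind (fun x => x <= _)) => // x y xw yw; rewrite ge_max xw.
rewrite ger0_norm ?mulr_ge0 ?ler0n ?(ltW w0) // => h1 h2.
rewrite -(ltr_pM2l w0); apply: lt_le_trans h1.
by rewrite mulrDl mulrDr mul1r mulrCA.
Qed.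

Theorem theorem1 (R : realType) (n q : nat) (p w delta1 : R)
    (hn : (0 < n)%N) (hp : 0 <= p <= 1) (hw : 0 < w)
    (hdelta : 0 < delta1 < 4^-1)
    (s : R) (hs : s = p * q%:R * n%:R)
    (hsmall : 4 * delta1 * (1 + s) + s < 1) :
  EVP q p n.-1 (4 * delta1 * (1 + s) + s) 0
    (total_reward (fun _ : block n => w)).
Proof.
move=> T cost M clock Z r Tn _ _ [_ _ zr rP _].
case/andP: (hp) => p0 p1; case/andP: hdelta => d0 _.
have [j jT] : exists j, j \notin T.
  apply/existsP; rewrite -negb_forall; apply/negP => /forallP T1.
  have : #|T| = n by rewrite -[RHS]card_ord; apply: eq_card => j; apply: T1.
  by lia.
set eps := _ + s; set m := (q * #|T|)%N.
have ms : m%:R * p <= s.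
  have : #|T|%:R <= n%:R :> R by rewrite ler_nat; lia.
  rewrite hs natrM mulrAC [_ * p]mulrC => h; apply: ler_wpM2l h.
  by rewrite mulr_ge0.
have m0 : 0 <= m%:R * p by rewrite mulr_ge0.
have seps : s < eps by rewrite ltrDr !mulr_gt0 //; lra.
pose eA kappa := execution q p Z T (fixed_cost q p M clock cost) kappa.
pose eH kappa := execution q p Z T (compliant q p T) kappa.
have vP kappa : always (fun e => True /\ synchronized e.2)
    (independent_pair (eA kappa) (eH kappa)).
  apply: (always_independent_pair (fun _ => True)).
    exact: valid_execution.
  exact: synchronized_execution.
pose bad (e : world n * world n) := ~~ (Umax (total_reward (fun _ => w)) T e.1
  <= Umin (total_reward (fun _ => w)) T e.2 +
     eps * `|Umin (total_reward (fun _ => w)) T e.2| + 0).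
have badP e : synchronized e.2 -> bad e ->
    (1 + eps) * (mined T (local_chain e.2 j))%:R < (most_mined T e.1)%:R.
  by move=> se; apply: reward_gap.
pose g kappa := Pr (independent_pair (eA kappa) (eH kappa)) bad.
rewrite -[X in negligible X]/g.
have g0 kappa : 0 <= g kappa.
  rewrite /g PrE.
  rewrite -[leLHS](expect_const (independent_pair (eA kappa) (eH kappa))).
  by apply: ler_expect (vP kappa) _ => e _; apply: ler0n.
(* If [m * p = 0], both moment factors equal 1 and no positive rate exists, so this case is treated
   apart. *)
have [th|th] := eqVneq (m%:R * p) 0; last first.
  have [||l [gamma [l0 gamma0 lg]]] := moment_tradeoff p (1 + eps) m hp.
  - by rewrite lt0r th.
  - by lra.
  apply: negligible_exp gamma0 rP _ => kappa; rewrite g0 /=.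
  have a1 : 1 <= expR l by rewrite -expR0 ler_expR ltW.
  have b01 : 0 <= expR (- (l * (1 + eps))) <= 1.
    by rewrite expR_ge0 expR_le1 oppr_le0 mulr_ge0 //; lra.
  have x0 : 0 <= (1 + p * (expR l - 1)) ^+ m.
    by rewrite exprn_ge0 // addr_ge0 // mulr_ge0 // subr_ge0.
  have y0 : 0 <= 1 - (1 - (1 - p) ^+ m) * (1 - expR (- (l * (1 + eps)))).
    have : 0 <= (1 - p) ^+ m by rewrite exprn_ge0 ?subr_ge0.
    have : (1 - p) ^+ m <= 1 by rewrite exprn_ile1 ?subr_ge0 ?gerBl.
    by case/andP: b01; nra.
  apply: le_trans (lerXn2r (r kappa) _ _ lg);
    rewrite ?nnegrE ?mulr_ge0 ?expR_ge0 // exprMn.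
  have MA := execution_moment (T := T) (M := M) (clock := clock) (cost := cost)
    (Z := Z) (kappa := kappa) (q := q) hp a1.
  have MH := compliant_execution_moment (T := T) (Z := Z) (kappa := kappa)
    (q := q) hp b01 j.
  rewrite !zr in MA MH.
  have nonneg c (f : world n -> nat) d : 0 <= c :> R -> valid d ->
      0 <= expect d (fun w => c ^+ f w).
    move=> c0 dV; rewrite -[leLHS](expect_const d).
    by apply: ler_expect dV _ => x _; rewrite exprn_ge0.
  apply: le_trans (ler_pM _ _ MA MH).
  (* Markov's inequality: on [bad] the product of the two powers is
     [expR (l * (V - (1 + eps) * C)) >= 1], and independence factors its expectation. *)
  - rewrite -expect_independent_pair /g PrE.
    apply: ler_expect (vP kappa) _ => e [_ se].
    have [be|_] := boolP (bad e); last first.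
      by rewrite mulr_ge0 ?exprn_ge0 ?expR_ge0.
    rewrite -!expRM_natr -expRD -[leLHS]expR0 ler_expR.
    rewrite mulNr -mulrA -mulrBr mulr_ge0 ?ltW // subr_gt0.
    exact: badP.
  - by apply: nonneg; rewrite ?expR_ge0 //; apply: valid_execution.
  - apply: nonneg; rewrite ?expR_ge0 //.
    by apply: always_imp (synchronized_execution hp j).
(* No query succeeds, so [E 2^V <= 1], while [1_(V >= 1) <= 2^V - 1]. *)
have gle kappa : g kappa <= 0.
  have two : 1 <= 2 :> R by rewrite ler1n.
  have MA := execution_moment (T := T) (M := M) (clock := clock) (cost := cost)
    (Z := Z) (kappa := kappa) (q := q) hp two.
  have z1 : (1 + p * (2 - 1)) ^+ m = 1 :> R.
    move/eqP: th; rewrite mulf_eq0 pnatr_eq0 => /orP[/eqP->|/eqP->].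
      by rewrite expr0.
    by rewrite mul0r addr0 expr1n.
  rewrite z1 expr1n in MA.
  apply: le_trans
    (_ : expect (eA kappa) (fun w => 2 ^+ most_mined T w - 1) <= _);
    last by rewrite expectB expect_const subr_le0.
  rewrite /g PrE expect_bind.
  apply: ler_expect (valid_execution hp) _ => e _.
  rewrite expect_bind /=.
  rewrite -[leRHS](expect_const (eH kappa)).
  apply: ler_expect (synchronized_execution hp j) _ => e' se' /=.
  have [be|_] := boolP (bad (e, e')); last by rewrite subr_ge0 exprn_ege1.
  have : 0 < (most_mined T e)%:R :> R.
    by apply: le_lt_trans (badP (e, e') se' be); rewrite mulr_ge0 //; lra.
  rewrite ltr0n lerBrDr; case: most_mined => // k _.
  by rewrite exprS /=; have : 1 <= 2 ^+ k :> R := exprn_ege1 k two; lra.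
move=> c; exists 0%N => k _ k0.
have -> : g k = 0 by apply: le_anti; rewrite gle g0.
by rewrite normr0 invr_gt0 exprn_gt0 ?ltr0n.
Qed.
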